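(* Let $(\mathbb{K},|\cdot|)$ be an algebraically closed normed field, let $f\in\mathbb{K}[z]$ be a polynomial of degree $n\ge 2$, let $N\ge1$ and $1\le p\le\infty$. Suppose $x^{(0)}\in\mathbb{K}^n$ is a vector with pairwise distinct components such that \[ E_f(x^{(0)})<\mathcal{R}=\frac{n(\sqrt[n]{2}-1)\big(a+2-n(\sqrt[n]{2}-1)\big)}{(a+2)\big(a+2+n(a-1)(\sqrt[n]{2}-1)\big)}, \] where $a=(n-1)^{1/q}$. Then $f$ has only simple zeros in $\mathbb{K}$, and the $N$th Weierstrass-type iteration $x^{(k+1)}=T^{(N)}(x^{(k)})$ starting from $x^{(0)}$ is well-defined and converges to a root-vector $\xi$ of $f$ with order of convergence $N+1$, and \[ \|x^{(k)}-\xi\|\preceq\alpha(E_f(x^{(k)}))\,\|W_f(x^{(k)})\| \] for all $k\ge0$ such that $E_f(x^{(k)})\le\mathcal{R}$.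
   Context: $(\mathbb{K},|\cdot|)$ is an algebraically closed normed field and $a_0$ denotes the leading coefficient of $f$. For $1\le p\le\infty$, $\|x\|_p=(\sum_{i=1}^n|x_i|^p)^{1/p}$ (with $\|x\|_\infty=\max_i|x_i|$), and $q\in[1,\infty]$ is the conjugate exponent, $1/p+1/q=1$. For $x\in\mathbb{K}^n$, $\|x\|=(|x_1|,\dots,|x_n|)\in\mathbb{R}^n$, and $\preceq$ is the coordinatewise order on $\mathbb{R}^n$. For $x\in\mathbb{K}^n$, $d(x)=(d_1(x),\dots,d_n(x))$ with $d_i(x)=\min_{j\ne i}|x_i-x_j|$; for $x\in\mathbb{K}^n$ and $y\in\mathbb{R}^n$ with nonzero components, $x/y=(|x_1|/y_1,\dots,|x_n|/y_n)$. A vector $\xi\in\mathbb{K}^n$ is a root-vector of $f$ if $f(z)=a_0\prod_{i=1}^n(z-\xi_i)$ for all $z\in\mathbb{K}$. Weierstrass correction: for $x$ with distinct components, $W_f(x)=(W_1(x),\dots,W_n(x))$, $W_i(x)=f(x_i)/\big(a_0\prod_{j\ne i}(x_i-x_j)\big)$, and $E_f(x)=\|W_f(x)/d(x)\|_p$. Weierstrass-type maps: $T^{(0)}(x)=x$ on $D_0=\mathbb{K}^n$; recursively, $D_{N+1}=\{x\in D_N: x_i\ne T^{(N)}_j(x)\text{ for all }i\ne j\}$ and for $x\in D_{N+1}$, $T^{(N+1)}_i(x)=x_i-\dfrac{f(x_i)}{a_0\prod_{j\ne i}(x_i-T^{(N)}_j(x))}$. The iteration $x^{(k+1)}=T^{(N)}(x^{(k)})$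 is well-defined if $x^{(k)}\in D_N$ for all $k$. $\alpha(t)=\dfrac{2}{1-(a-1)t+\sqrt{(1-(a-1)t)^2-4t}}$. *)

(* Defs.v *)
From HB Require Import structures.
From mathcomp Require Import all_boot all_order all_algebra.
From mathcomp Require Import reals constructive_ereal exp.
Set Implicit Arguments. Unset Strict Implicit. Unset Printing Implicit Defensive.
Import Order.TTheory GRing.Theory Num.Theory.
Local Open Scope ring_scope.

Section WeierstrassDefs.
Variables (R : realType) (K : closedFieldType).

Definition is_absolute_value (abs : K -> R) : Prop :=
  [/\ forall x, 0 <= abs x,
      forall x, abs x = 0 <-> x = 0,
      forall x y, abs (x * y) = abs x * abs y &
      forall x y, abs (x + y) <= abs x + abs y].

Variable n : nat.

Definition pnorm (p : \bar R) (v : 'I_n -> R) : R :=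
  match p with
  | +oo%E => \big[Num.max/0]_(i < n) `|v i|
  | EFin r => (\sum_(i < n) `|v i| `^ r) `^ r^-1
  | -oo%E => 0
  end.

(* 1/q where q is the conjugate exponent of p, 1/p + 1/q = 1. *)
Definition inv_conj (p : \bar R) : R :=
  match p with
  | EFin r => 1 - r^-1
  | _ => 1
  end.

Definition a_param (p : \bar R) : R := (n.-1)%:R `^ inv_conj p.

Variable abs : K -> R.

(* d_i(x) = min_{j <> i} |x_i - x_j|.  The neutral element of the min is
   \sum_j |x_i - x_j|, which dominates every term, so for n >= 2 this is
   exactly the minimum over j <> i. *)
Definition dmin (x : 'I_n -> K) (i : 'I_n) : R :=
  \big[Num.min/ (\sum_(j < n) abs (x i - x j))]_(j < n | j != i) abs (x i - x j).

Variable f : {poly K}.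

Definition Wcorr (x : 'I_n -> K) (i : 'I_n) : K :=
  f.[x i] / (lead_coef f * \prod_(j < n | j != i) (x i - x j)).

Definition Ef (p : \bar R) (x : 'I_n -> K) : R :=
  pnorm p (fun i => abs (Wcorr x i) / dmin x i).

Fixpoint Tmap (N : nat) (x : 'I_n -> K) : 'I_n -> K :=
  match N with
  | 0 => x
  | N'.+1 => fun i =>
      x i - f.[x i] / (lead_coef f * \prod_(j < n | j != i) (x i - Tmap N' x j))
  end.

Fixpoint Dom (N : nat) (x : 'I_n -> K) : Prop :=
  match N with
  | 0 => True
  | N'.+1 => Dom N' x /\ (forall i j : 'I_n, i != j -> x i != Tmap N' x j)
  end.

Definition iterates (N : nat) (x0 : 'I_n -> K) (k : nat) : 'I_n -> K :=
  iter k (Tmap N) x0.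

Definition root_vector (xi : 'I_n -> K) : Prop :=
  forall z : K, f.[z] = lead_coef f * \prod_(i < n) (z - xi i).

Definition errmax (x y : 'I_n -> K) : R :=
  \big[Num.max/0]_(i < n) abs (x i - y i).

Definition converges_to (u : nat -> 'I_n -> K) (xi : 'I_n -> K) : Prop :=
  forall eps : R, 0 < eps -> exists k0 : nat,
    forall k, (k0 <= k)%N -> forall i, abs (u k i - xi i) < eps.

Definition conv_order (u : nat -> 'I_n -> K) (xi : 'I_n -> K) (r : nat) : Prop :=
  exists C : R, 0 <= C /\
    forall k, errmax (u k.+1) xi <= C * errmax (u k) xi ^+ r.

End WeierstrassDefs.

Definition alpha (R : realType) (a t : R) : R :=
  2 / (1 - (a - 1) * t + Num.sqrt ((1 - (a - 1) * t) ^+ 2 - 4 * t)).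

Definition radius (R : realType) (n : nat) (a : R) : R :=
  let c := n%:R * (2 `^ (n%:R)^-1 - 1) in
  c * (a + 2 - c) / ((a + 2) * (a + 2 + (a - 1) * c)).

(* Main.v *)
(* Localization.  Let [W] be the Weierstrass correction at [x] and [h] the monic
   quotient of [f] by [X - z] for a root [z].  Lagrange interpolation of [h] at
   the nodes [x] writes its leading coefficient as [1 = sum_j q_j], where
   [W_j = (x_j - z) q_j].  Comparing sizes at the node closest to [z] puts every
   root in a disc [|z - x_i| <= r d_i(x)] with [r = n (2^(1/n) - 1) / (a + 2)];
   the same identity for a quotient by two roots (leading coefficient [0] in
   degree [n - 1]) shows that no disc holds two roots, even counted with
   multiplicity.  As the [n] discs are thus in bijection with the [n] roots, this
   needs neither completeness of the field nor continuity of roots.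

   Convergence.  With [e_j = |x_j - xi_j| / d_j(x)], the bounds [e_i <= r] and
   [sum_(j != i) e_j <= a r] are invariant under [T^(N)]: the relative error of
   the [i]-th component is at most [prod_(j != i) (1 + e_j) - 1], and AM-GM gives
   [(1 + 2 r) prod_(j != i) (1 + e_j) <= (1 + (a + 2) r / n)^n = 2].  Errors thus
   shrink by [(1 - 2 r) / (1 + 2 r)], and the distances [d_i] shrink by no more
   than this same factor. *)
Require Import Defs.
From HB Require Import structures.
From mathcomp Require Import all_boot all_order all_algebra.
From mathcomp Require Import reals constructive_ereal exp.
From mathcomp Require Import ring lra.
Set Implicit Arguments. Unset Strict Implicit. Unset Printing Implicit Defensive.
Import Order.TTheory GRing.Theory Num.Theory.
Local Open Scope ring_scope.

(** * Absolute values and the minimal distance between nodes *)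

Lemma other_ord (n : nat) (i : 'I_n) : (2 <= n)%N -> exists j, j != i.
Proof.
move=> n2; have : (0 < #|predC1 i|)%N.
  by rewrite -(ltn_add2l #|pred1 i|) cardC card_ord card1.
by case/card_gt0P => j; exists j.
Qed.

Section AbsoluteValue.
Variables (R : realType) (K : closedFieldType) (abs : K -> R).
Hypothesis absP : is_absolute_value abs.

Lemma abs_ge0 u : 0 <= abs u. Proof. by case: absP. Qed.

Lemma abs_eq0 u : (abs u == 0) = (u == 0).
Proof. by case: absP => _ h _ _; apply/eqP/eqP => /h. Qed.

Lemma abs0 : abs 0 = 0. Proof. by apply/eqP; rewrite abs_eq0. Qed.

Lemma abs_gt0 u : (0 < abs u) = (u != 0).
Proof. by rewrite lt_neqAle abs_ge0 andbT eq_sym abs_eq0. Qed.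

Lemma absM u v : abs (u * v) = abs u * abs v. Proof. by case: absP. Qed.

Lemma ler_absD u v : abs (u + v) <= abs u + abs v. Proof. by case: absP. Qed.

Lemma abs1 : abs 1 = 1.
Proof.
have h : abs 1 != 0 by rewrite abs_eq0 oner_eq0.
by apply: (mulfI h); rewrite -absM !mulr1.
Qed.

Lemma absN u : abs (- u) = abs u.
Proof.
suff h : abs (-1) = 1 by rewrite -mulN1r absM h mul1r.
apply/eqP; rewrite -(@eqrXn2 _ 2) ?abs_ge0 ?ler01 //.
by rewrite expr1n expr2 -absM mulrNN mul1r abs1.
Qed.

Lemma abs_distC u v : abs (u - v) = abs (v - u).
Proof. by rewrite -absN opprB. Qed.

Lemma absV u : abs u^-1 = (abs u)^-1.
Proof.
have [->|u0] := eqVneq u 0; first by rewrite invr0 abs0 invr0.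
have h : abs u != 0 by rewrite abs_eq0.
by apply: (mulfI h); rewrite -absM divff // divff // abs1.
Qed.

Lemma abs_dist_triangle u v w : abs (u - w) <= abs (u - v) + abs (v - w).
Proof. by apply: le_trans (ler_absD _ _); rewrite addrA subrK. Qed.

Lemma abs_sum (I : finType) (P : pred I) (F : I -> K) :
  abs (\sum_(i | P i) F i) <= \sum_(i | P i) abs (F i).
Proof.
elim/big_ind2: _ => [|u1 v1 u2 v2 h1 h2|//]; first by rewrite abs0.
exact: le_trans (ler_absD _ _) (lerD h1 h2).
Qed.

(** By induction on the product: u v - 1 = (u - 1)(v - 1) + (u - 1) + (v - 1), and each term on the
    right is bounded by its counterpart for the majorants. *)
Lemma abs_prod1_le (I : finType) (P : pred I) (F : I -> K) :
  abs (\prod_(i | P i) (1 + F i) - 1) <= \prod_(i | P i) (1 + abs (F i)) - 1.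
Proof.
elim/big_ind2: _ => [|v1 u1 v2 u2 h1 h2|i _]; last 1 first.
- by rewrite !(addrC 1) !addrK.
- by rewrite !subrr abs0.
have -> : u1 * u2 - 1 = (u1 - 1) * (u2 - 1) + (u1 - 1) + (u2 - 1) by ring.
have := ler_absD ((u1 - 1) * (u2 - 1) + (u1 - 1)) (u2 - 1).
have := ler_absD ((u1 - 1) * (u2 - 1)) (u1 - 1).
rewrite absM; have := abs_ge0 (u1 - 1); have := abs_ge0 (u2 - 1).
have := ler_pM (abs_ge0 (u1 - 1)) (abs_ge0 (u2 - 1)) h1 h2.
lra.
Qed.

Section MinimalDistance.
Variable n : nat.
Implicit Types x : 'I_n -> K.

Lemma dmin_le x i j : j != i -> dmin abs x i <= abs (x i - x j).
Proof. by move=> ij; apply: bigmin_le_cond. Qed.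

Lemma le_dmin x i c : (2 <= n)%N ->
  (forall j, j != i -> c <= abs (x i - x j)) -> c <= dmin abs x i.
Proof.
move=> n2 h; apply/bigmin_geP; split=> //.
(* The default value of the minimum is the sum of all distances from [x i]; it dominates any one of
   them, and a second index exists since n >= 2. *)
have [j ji] := other_ord i n2.
apply: le_trans (h j ji) _.
by rewrite (bigD1 j) //= lerDl sumr_ge0 // => k _; apply: abs_ge0.
Qed.

Lemma dmin_gt0 x i : (2 <= n)%N -> (forall i j, i != j -> x i != x j) ->
  0 < dmin abs x i.
Proof.
move=> n2 hx; have h j : j != i -> 0 < abs (x i - x j).
  by move=> ji; rewrite abs_gt0 subr_eq0 hx // eq_sym.
apply/bigmin_gtP; split=> //.
have [j ji] := other_ord i n2; apply: lt_le_trans (h j ji) _.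
by rewrite (bigD1 j) //= lerDl sumr_ge0 // => k _; apply: abs_ge0.
Qed.

End MinimalDistance.
End AbsoluteValue.

(** * Lagrange interpolation and the leading coefficient *)

Section LagrangeInterpolation.
Variables (K : fieldType) (n : nat) (x : 'I_n -> K).
Hypothesis x_inj : forall i j, i != j -> x i != x j.

(** The coordinate of [h] along the monic polynomial prod_(k != j) (X - x_k) in the Lagrange
    basis. *)
Definition lagrange_weight (h : {poly K}) (j : 'I_n) : K :=
  h.[x j] / \prod_(k < n | k != j) (x j - x k).

(** [h] and its interpolant agree at n points and have degree below n, so they coincide; every basis
    polynomial [b j] is monic of degree n - 1. The degree of [h] may be smaller than n - 1, and then
    the sum vanishes. *)
Lemma sum_lagrange_weight (h : {poly K}) : (size h <= n)%N ->
  \sum_j lagrange_weight h j = h`_n.-1.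
Proof.
move=> sh; pose b j : {poly K} := \prod_(k < n | k != j) ('X - (x k)%:P).
have bE j : b j = \prod_(k <- enum (predC1 j)) ('X - (x k)%:P) by rewrite big_enum.
have size_b j : size (b j) = n.
  by rewrite bE size_prod_XsubC -cardE -add1n -[in LHS](card1 j) cardC card_ord.
pose L : {poly K} := \sum_j lagrange_weight h j *: b j.
have size_L : (size L <= n)%N.
  apply: (leq_trans (size_sum _ _ _)); apply/bigmax_leqP => j _.
  by rewrite (leq_trans (size_scale_leq _ _)) // size_b.
have Lx i : L.[x i] = h.[x i].
  rewrite horner_sum (bigD1 i) //= big1 ?addr0 => [|j ji].
    rewrite hornerZ horner_prod.
    under [in X in _ * X]eq_bigr => k _ do rewrite hornerXsubC.
    rewrite divfK //; apply/prodf_neq0 => k ki.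
    by rewrite subr_eq0 x_inj // eq_sym.
  rewrite hornerZ horner_prod (bigD1 i) 1?eq_sym //=.
  by rewrite hornerXsubC subrr mul0r mulr0.
have -> : h = L.
  apply/eqP; rewrite -subr_eq0; apply/negPn/negP => nz.
  have /= := @max_poly_roots _ _ [seq x i | i <- enum 'I_n] nz.
  rewrite size_map size_enum_ord ltnNge (leq_trans (size_polyD _ _)); last first.
    by rewrite size_polyN geq_max sh.
  suff [-> ->] : all (root (h - L)) [seq x i | i <- enum 'I_n] /\
     uniq [seq x i | i <- enum 'I_n] by move=> /(_ isT isT).
  split; first by apply/allP => _ /mapP[i _ ->]; rewrite rootE hornerD hornerN Lx subrr.
  rewrite map_inj_uniq ?enum_uniq // => i j xij.
  by apply/eqP/negPn/negP => /x_inj; rewrite xij eqxx.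
rewrite coef_sum; apply: eq_bigr => j _; rewrite coefZ.
suff -> : (b j)`_n.-1 = 1 by rewrite /lagrange_weight mulr1 Lx.
have := monic_prod_XsubC (enum (predC1 j)) xpredT x.
by rewrite -bE monicE /lead_coef size_b => /eqP.
Qed.

End LagrangeInterpolation.

(** * Inequalities around the quadratic e (1 - e) = t (1 + (a - 1) e) *)

Section RadiusInequalities.
Variables (F : realFieldType) (a r t : F).
Implicit Type e : F.

(** Compares t with the value of e (1 - e) / (1 + (a - 1) e) at e = 1/2. After clearing denominators
    the gap is (1 - 2 r)(1 - (a + 1) r). *)
Lemma locus_value_le :
  1 <= a -> 0 < r -> r * (a + 2) <= 1 -> t * (1 + (a - 1) * r) <= r * (1 - r) ->
  2 * (a + 1) * t <= 1.
Proof.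
move=> a_ge1 r_gt0 r_le t_le.
have ar_ge0 : 0 <= (a - 1) * r by rewrite mulr_ge0 ?subr_ge0 // ltW.
have pos : 0 < 1 + (a - 1) * r by lra.
rewrite -(ler_pM2r pos) mul1r -mulrA.
have : 2 * (a + 1) * (t * (1 + (a - 1) * r)) <= 2 * (a + 1) * (r * (1 - r)).
  by rewrite ler_wpM2l //; lra.
have : 0 <= (1 - 2 * r) * (1 - (a + 1) * r) by apply: mulr_ge0; lra.
lra.
Qed.

(** The strict bound that two roots in one disc would violate. *)
Lemma locus_value_lt :
  1 <= a -> 0 < r -> r * (a + 2) <= 1 -> t * (1 + (a - 1) * r) <= r * (1 - r) ->
  a * t < (1 - r) ^+ 2.
Proof.
move=> a_ge1 r_gt0 r_le t_le.
have ar_ge0 : 0 <= (a - 1) * r by rewrite mulr_ge0 ?subr_ge0 // ltW.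
have pos : 0 < 1 + (a - 1) * r by lra.
rewrite -(ltr_pM2r pos) -mulrA.
have h1 : a * (t * (1 + (a - 1) * r)) <= a * (r * (1 - r)).
  by rewrite ler_wpM2l //; lra.
apply: (le_lt_trans h1).
have h : 0 < (1 - r) * (1 - 2 * r - (a - 1) * r * r).
  apply: mulr_gt0; first lra.
  have : (a - 1) * r * r <= r by rewrite ler_piMl; nra.
  nra.
rewrite -subr_gt0; set u := (X in 0 < X).
by have -> : u = (1 - r) * (1 - 2 * r - (a - 1) * r * r) by rewrite /u; ring.
Qed.

(** Eliminating t leaves (e - r)(1 - e - r - (a - 1) r e) <= 0, and the second factor is positive
    for e <= 1/2. The bound on e discards the larger root of the quadratic. *)
Lemma locus_small_root e :
  1 <= a -> 0 < r -> r * (a + 2) <= 1 -> t * (1 + (a - 1) * r) <= r * (1 - r) ->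
  0 <= e -> e <= 2^-1 ->
  e * (1 - e) <= t * (1 + (a - 1) * e) -> e <= r.
Proof.
move=> a_ge1 r_gt0 r_le t_le e0 e2 he; rewrite leNgt; apply/negP => lt_re.
have ar_ge0 : 0 <= (a - 1) * r by rewrite mulr_ge0 ?subr_ge0 // ltW.
have pos : 0 < 1 + (a - 1) * r by lra.
have ae : 0 <= (a - 1) * e by rewrite mulr_ge0 // subr_ge0.
have h1 : e * (1 - e) * (1 + (a - 1) * r) <= t * (1 + (a - 1) * e) * (1 + (a - 1) * r).
  by rewrite ler_wpM2r // ltW.
have h2 : t * (1 + (a - 1) * r) * (1 + (a - 1) * e) <= r * (1 - r) * (1 + (a - 1) * e).
  by rewrite ler_wpM2r //; lra.
have h3 : 0 < (e - r) * (1 - e - r - (a - 1) * r * e).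
  apply: mulr_gt0; first lra.
  have : (a - 1) * r * e <= (a - 1) * r * 2^-1 by rewrite ler_wpM2l.
  lra.
lra.
Qed.

End RadiusInequalities.

(* [alpha a t * t] is the smaller root of [e (1 - e) = t (1 + (a - 1) e)]. *)
Lemma alpha_bounds (R : realType) (a r t e : R) :
  1 <= a -> 0 < r -> r * (a + 2) <= 1 -> 0 <= t ->
  t * (1 + (a - 1) * r) <= r * (1 - r) ->
  0 <= e -> e <= r -> e * (1 - e) <= t * (1 + (a - 1) * e) ->
  [/\ 0 < alpha a t, alpha a t * t <= r &
      (alpha a t)^-1 <= 1 - a * t / (1 - e)].
Proof.
move=> a1 r0 ra t0 tr e0 er et; rewrite /alpha.
set B := 1 - (a - 1) * t; set S := Num.sqrt _.
have ar0 : 0 <= (a - 1) * r by rewrite mulr_ge0 ?subr_ge0 // ltW.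
have t_r : t <= r.
  have : 0 <= t * ((a - 1) * r) by rewrite mulr_ge0.
  nra.
have at_ar : (a - 1) * t <= (a - 1) * r by rewrite ler_wpM2l // subr_ge0.
have B_ge : 2 * r <= B by rewrite /B; lra.
have S0 : 0 <= S by exact: sqrtr_ge0.
have SB u : u <= B -> u ^+ 2 <= B ^+ 2 - 4 * t -> u <= S.
  move=> _ h; apply: le_trans (ler_norm u) _.
  by rewrite -sqrtr_sqr ler_wsqrtr.
(* With u = (B - S) / 2 the smaller root of u^2 - B u + t, this is u <= r; [S_e] below is e <= u. *)
have S_r : B - 2 * r <= S by apply: SB; rewrite /B; nra.
have D0 : 0 <= B ^+ 2 - 4 * t by have := sqr_ge0 (B - 2 * r); rewrite /B; nra.
have SE : S ^+ 2 = B ^+ 2 - 4 * t by rewrite sqr_sqrtr.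
have S_e : S <= B - 2 * e.
  rewrite -[leRHS]ger0_norm; last by lra.
  rewrite -sqrtr_sqr ler_wsqrtr // /B; nra.
have BS : 0 < B + S by lra.
split; first by rewrite divr_gt0.
- rewrite mulrAC ler_pdivrMr //; nra.
- rewrite invf_div.
  have e1 : 0 < 1 - e by nra.
  (* The value at 1 of u^2 - B u + t, factored over its two roots; the larger root (B + S) / 2 is
     the inverse of alpha. *)
  have h : (1 - (B - S) / 2) * (1 - (B + S) / 2) = a * t.
    suff -> : (1 - (B - S) / 2) * (1 - (B + S) / 2) = 1 - B + (B ^+ 2 - S ^+ 2) / 4.
      by rewrite SE /B; field.
    by field.
  have u0 : 0 <= 1 - (B + S) / 2.
    have : 0 <= (1 - (B - S) / 2) * (1 - (B + S) / 2) by rewrite h mulr_ge0; lra.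
    rewrite pmulr_rge0 //; nra.
  have : a * t / (1 - e) <= 1 - (B + S) / 2.
    rewrite ler_pdivrMr // -h mulrC ler_wpM2l //; lra.
  lra.
Qed.

(** * Localization: one disc around each node, one simple root in each disc *)

Section Localization.
Variables (R : realType) (K : closedFieldType) (abs : K -> R).
Hypothesis absP : is_absolute_value abs.
Variables (n : nat) (f : {poly K}) (x : 'I_n -> K).
Hypotheses (n_ge2 : (2 <= n)%N) (size_f : size f = n.+1).
Hypothesis x_inj : forall i j, i != j -> x i != x j.

Local Notation d := (dmin abs x).
Local Notation q := (lagrange_weight x).

Lemma f_neq0 : f != 0. Proof. by rewrite -size_poly_eq0 size_f. Qed.

Lemma monic_factor (g : {poly K}) : g \is monic -> g %| f ->
  exists h, [/\ f = lead_coef f *: (g * h), h \is monic & (size g + size h)%N = n.+2].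
Proof.
move=> g_monic /Pdiv.Field.dvdpP[h0 fE].
have g0 := monic_neq0 g_monic.
have h0_neq0 : h0 != 0 by apply: contraNneq f_neq0 => h00; rewrite fE h00 mul0r.
have lc : lead_coef f = lead_coef h0 by rewrite fE lead_coef_Mmonic.
have c0 : lead_coef h0 != 0 by rewrite lead_coef_eq0.
exists ((lead_coef h0)^-1 *: h0); split.
- by rewrite lc scalerAr scalerA divff // scale1r mulrC.
- by rewrite monicE lead_coefZ mulVf.
- rewrite size_scale ?invr_eq0 // -size_f fE size_mul // addnC prednK //.
  by rewrite ltn_addr // lt0n size_poly_eq0.
Qed.

(** The Weierstrass correction and the Lagrange weight have the same node product as denominator. It
    is used with [g] a product of one or two linear factors. *)
Lemma Wcorr_factor (g h : {poly K}) j : f = lead_coef f *: (g * h) ->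
  Wcorr f x j = g.[x j] * q h j.
Proof.
move=> fE; rewrite /Wcorr /lagrange_weight {1}fE hornerZ hornerM -mulf_div.
by rewrite divff ?lead_coef_eq0 ?f_neq0 // mul1r mulrA.
Qed.

Variables (a E r : R).
Hypotheses (a_ge1 : 1 <= a) (r_gt0 : 0 < r) (r_le : r * (a + 2) <= 1).
Hypothesis E_le : E * (1 + (a - 1) * r) <= r * (1 - r).
Hypothesis W_le : forall i, abs (Wcorr f x i) / d i <= E.
Hypothesis sumW_le : forall i,
  \sum_(j < n | j != i) abs (Wcorr f x j) / d j <= a * E.

Lemma d_gt0 i : 0 < d i. Proof. exact: dmin_gt0. Qed.
Local Hint Resolve d_gt0 : core.

Lemma E_ge0 : 0 <= E.
Proof.
apply: le_trans _ (W_le (Ordinal (ltnW n_ge2))).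
by rewrite divr_ge0 ?abs_ge0 ?ltW ?d_gt0.
Qed.

Lemma r_lt1 : r < 1. Proof. move: a_ge1 r_gt0 r_le; nra. Qed.

Lemma W_le_d i : abs (Wcorr f x i) <= E * d i.
Proof. by rewrite -ler_pdivrMr ?W_le. Qed.

(** The norm enters only through [W_le] and its Hölder consequence [sumW_le]; the latter is
    transferred here to weights. *)
Lemma sum_weight_le (Q : 'I_n -> K) i s : 0 < s ->
  (forall j, j != i -> s * abs (Q j) <= abs (Wcorr f x j) / d j) ->
  \sum_(j < n | j != i) abs (Q j) <= a * E / s.
Proof.
move=> s0 h; rewrite ler_pdivlMr // mulrC mulr_sumr.
exact: le_trans (ler_sum _ h) (sumW_le i).
Qed.

(* The leading coefficient of [f / (lead_coef f (X - z))] is 1, which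
   Lagrange interpolation at [x] rewrites as a sum of weights. *)
Lemma root_weight_ge1 z h i s : f = lead_coef f *: (('X - z%:P) * h) ->
  h \is monic -> size h = n -> 0 < s ->
  (forall j, j != i -> s * d j <= abs (x j - z)) ->
  1 <= abs (q h i) + a * E / s.
Proof.
move=> fE h_monic size_h s0 hs.
have sum1 : \sum_j q h j = 1.
  by rewrite sum_lagrange_weight ?size_h // -size_h; apply/eqP; rewrite -monicE.
rewrite -(abs1 absP) -sum1 (bigD1 i) //=.
apply: le_trans (ler_absD absP _ _) _; rewrite lerD2l.
apply: le_trans (abs_sum absP _ _) _.
apply: sum_weight_le => // j ji; rewrite (Wcorr_factor j fE) (absM absP _ (q h j)).
rewrite hornerXsubC ler_pdivlMr // mulrAC ler_wpM2r ?abs_ge0 //.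
exact: hs.
Qed.

Lemma far_from_other i j z e : 0 <= e -> j != i ->
  abs (x i - z) <= e * d i -> (1 - e) * abs (x i - x j) <= abs (x j - z).
Proof.
move=> e0 ji hz; have := abs_dist_triangle absP (x i) z (x j).
rewrite (abs_distC absP z (x j)).
have : e * d i <= e * abs (x i - x j) by rewrite ler_wpM2l ?dmin_le.
lra.
Qed.

(** Multiplied by e (1 - e) and combined with e |q_i| <= E, this yields the quadratic inequality e
    (1 - e) <= E (1 + (a - 1) e). *)
Lemma root_quadratic z h i e : f = lead_coef f *: (('X - z%:P) * h) ->
  h \is monic -> size h = n -> 0 <= e < 1 -> abs (x i - z) = e * d i ->
  1 <= abs (q h i) + a * E / (1 - e).
Proof.
move=> fE h_monic size_h /andP[e0 e1] ez.
apply: (root_weight_ge1 fE) => //; first by rewrite subr_gt0.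
move=> j ji; apply: le_trans (far_from_other e0 ji _); last by rewrite ez.
rewrite ler_wpM2l ?subr_ge0 ?(ltW e1) // (abs_distC absP).
by apply: dmin_le; rewrite eq_sym.
Qed.

Lemma root_factor z : root f z -> exists h,
  [/\ f = lead_coef f *: (('X - z%:P) * h), h \is monic & size h = n].
Proof.
rewrite -dvdp_XsubCl => /(monic_factor (monicXsubC z))[h [fE hm hs]].
by exists h; split=> //; move: hs; rewrite size_XsubC; case.
Qed.

Lemma root_in_disc z : root f z -> exists i, abs (x i - z) <= r * d i.
Proof.
move=> /root_factor[h [fE hm hs]].
have [i _ hi] := @arg_minP _ _ _ (Ordinal (ltnW n_ge2)) xpredT
  (fun i => abs (x i - z)) isT.
exists i; pose e := abs (x i - z) / d i.
have ez : abs (x i - z) = e * d i by rewrite /e divfK ?gt_eqF.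
have e0 : 0 <= e by rewrite /e divr_ge0 ?abs_ge0 // ltW.
have Wi : abs (Wcorr f x i) = e * d i * abs (q h i).
  by rewrite (Wcorr_factor i fE) (absM absP _ (q h i)) hornerXsubC ez.
have hW : e * abs (q h i) <= E.
  by rewrite -(ler_pM2r (d_gt0 i)) mulrAC -Wi W_le_d.
have [[ha hr] hr2] := (a_ge1, r_gt0, r_le).
have hE0 := E_ge0.
have hE := locus_value_le a_ge1 r_gt0 r_le E_le.
(* As [x i] is the node closest to z, d_j <= |x_i - x_j| <= 2 |x_j - z|. This crude constant 1/2
   only serves to get e <= 1/2; the sharper 1 - e is used afterwards. *)
have h1 : 1 <= abs (q h i) + a * E / 2^-1.
  apply: (root_weight_ge1 fE) => // [|j ji]; first by rewrite invr_gt0.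
  rewrite mulrC ler_pdivrMr //.
  have ij : i != j by rewrite eq_sym.
  have := dmin_le abs x ij.
  have := abs_dist_triangle absP (x j) z (x i).
  have := hi j isT; rewrite /= (abs_distC absP z (x i)); lra.
rewrite invrK in h1.
have e_le : e <= 2^-1.
  have h2 : e <= e * (abs (q h i) + a * E * 2) by rewrite ler_peMr.
  have : e * (1 - a * E * 2) <= E by lra.
  have : 0 < 1 - a * E * 2 by nra.
  nra.
have /(root_quadratic fE hm hs) : 0 <= e < 1 by rewrite e0; lra.
move=> /(_ i ez) h2; rewrite ez ler_wpM2r //; first exact: ltW.
apply: (locus_small_root a_ge1 r_gt0 r_le E_le) => //.
have h3 : (1 - e) <= abs (q h i) * (1 - e) + a * E.
  have p : 0 < 1 - e by lra.
  by move: h2; rewrite -(ler_pM2r p) mul1r mulrDl divfK ?gt_eqF.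
have : e * (1 - e) <= e * (abs (q h i) * (1 - e) + a * E) by rewrite ler_wpM2l.
have : e * abs (q h i) * (1 - e) <= E * (1 - e) by rewrite ler_wpM2r //; lra.
lra.
Qed.

(** The weights of the quotient by both factors sum to 0, so |q_i| is bounded by the other weights.
    Inserted in the one-root estimate for (X - z') h, this gives 1 <= r a E / (1 - r)^2 + a E / (1 -
    r) = a E / (1 - r)^2, which is false. The case z = z' gives simplicity. *)
Lemma one_root_per_disc i z z' :
  abs (x i - z) <= r * d i -> abs (x i - z') <= r * d i ->
  ~~ (('X - z%:P) * ('X - z'%:P) %| f).
Proof.
move=> hz hz'; apply/negP => /monic_factor.
case=> [|h [fE hm hs]]; first by rewrite monicMl monicXsubC.
have size_h : size h = n.-1.
  move: hs; rewrite size_mul ?polyXsubC_eq0 // !size_XsubC /=.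
  by move=> /eqP; rewrite !addSn !eqSS add0n => /eqP <-.
have r1 : 0 < 1 - r by rewrite subr_gt0 r_lt1.
have r0 := ltW r_gt0.
have W_E j : Wcorr f x j = (x j - z) * (x j - z') * q h j.
  by rewrite (Wcorr_factor j fE) hornerM !hornerXsubC.
have sum0 : \sum_j q h j = 0.
  rewrite sum_lagrange_weight ?size_h ?leq_pred //.
  by rewrite nth_default // size_h.
(* Both d_i and d_j are at most |x_i - x_j|, hence |W_j| / d_j >= (1 - r)^2 d_i |q_j|. *)
have q_le : abs (q h i) <= a * E / (d i * (1 - r) ^+ 2).
  move: sum0; rewrite (bigD1 i) //= => /eqP; rewrite addr_eq0 => /eqP ->.
  rewrite absN //; apply: le_trans (abs_sum absP _ _) _.
  apply: sum_weight_le => [|j ji]; first by rewrite mulr_gt0 ?exprn_gt0.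
  rewrite ler_pdivlMr // W_E (absM absP _ (q h j)) mulrAC ler_wpM2r ?abs_ge0 //.
  have dj : d j <= abs (x i - x j).
    by rewrite (abs_distC absP) dmin_le // eq_sym.
  have p0 : 0 <= (1 - r) * abs (x i - x j) by rewrite mulr_ge0 ?abs_ge0 ?(ltW r1).
  rewrite absM //; apply: le_trans (ler_pM p0 p0 (far_from_other r0 ji hz)
    (far_from_other r0 ji hz')).
  rewrite (mulrC (d i)) -mulrA [leRHS]mulrACA -expr2 ler_wpM2l ?exprn_ge0 ?(ltW r1) //.
  by rewrite ler_pM ?(ltW (d_gt0 _)) ?dmin_le.
have fE' : f = lead_coef f *: (('X - z%:P) * (('X - z'%:P) * h)).
  by rewrite mulrA.
have : 1 <= abs (q (('X - z'%:P) * h) i) + a * E / (1 - r).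
  apply: (root_weight_ge1 fE'); rewrite ?monicMl ?monicXsubC //.
    rewrite size_mul ?polyXsubC_eq0 ?monic_neq0 // size_XsubC size_h.
    by rewrite addSn /= add1n prednK // ltnW.
  move=> j ji; apply: le_trans (far_from_other r0 ji hz).
  rewrite ler_wpM2l ?(ltW r1) // (abs_distC absP).
  by apply: dmin_le; rewrite eq_sym.
have -> : q (('X - z'%:P) * h) i = (x i - z') * q h i.
  by rewrite /lagrange_weight hornerM hornerXsubC mulrA.
rewrite (absM absP _ (q h i)) => h1.
have h2 : abs (x i - z') * abs (q h i) <= r * (a * E) / (1 - r) ^+ 2.
  apply: le_trans (ler_pM (abs_ge0 absP _) (abs_ge0 absP _) hz' q_le) _.
  rewrite le_eqVlt; apply/predU1P; left; field.
  by rewrite !gt_eqF.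
have h3 : (1 - r) ^+ 2 <= a * E.
  have p : 0 < (1 - r) ^+ 2 by rewrite exprn_gt0.
  rewrite -[leLHS]mul1r -ler_pdivlMr //.
  have -> : a * E / (1 - r) ^+ 2 = r * (a * E) / (1 - r) ^+ 2 + a * E / (1 - r).
    by field; rewrite gt_eqF.
  by apply: le_trans h1 _; rewrite lerD2r.
by move: (locus_value_lt a_ge1 r_gt0 r_le E_le); rewrite ltNge h3.
Qed.

(** |W_i| = |x_i - z| |q_i|, and |q_i| >= 1 - a E / (1 - e), which is at least the inverse of
    alpha. *)
Lemma root_dist_alpha i z : root f z -> abs (x i - z) <= r * d i ->
  [/\ 0 < alpha a E, abs (x i - z) <= alpha a E * abs (Wcorr f x i) &
      alpha a E * E <= r].
Proof.
move=> /root_factor[h [fE hm hs]] hz.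
pose e := abs (x i - z) / d i.
have ez : abs (x i - z) = e * d i by rewrite /e divfK ?gt_eqF.
have e0 : 0 <= e by rewrite /e divr_ge0 ?abs_ge0 ?ltW.
have er : e <= r by rewrite /e ler_pdivrMr.
have e1 : e < 1 by apply: le_lt_trans er r_lt1.
have Wi : abs (Wcorr f x i) = e * d i * abs (q h i).
  by rewrite (Wcorr_factor i fE) (absM absP _ (q h i)) hornerXsubC ez.
have hW : e * abs (q h i) <= E.
  by rewrite -(ler_pM2r (d_gt0 i)) mulrAC -Wi W_le_d.
have p : 0 < 1 - e by rewrite subr_gt0.
have hq : 1 <= abs (q h i) + a * E / (1 - e).
  by apply: (root_quadratic fE hm hs) ez; rewrite e0.
have he : e * (1 - e) <= E * (1 + (a - 1) * e).
  have h3 : (1 - e) <= abs (q h i) * (1 - e) + a * E.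
    by move: hq; rewrite -(ler_pM2r p) mul1r mulrDl divfK ?gt_eqF.
  have : e * (1 - e) <= e * (abs (q h i) * (1 - e) + a * E) by rewrite ler_wpM2l.
  have : e * abs (q h i) * (1 - e) <= E * (1 - e) by rewrite ler_wpM2r // ltW.
  lra.
have [al0 alE al] := alpha_bounds a_ge1 r_gt0 r_le E_ge0 E_le e0 er he.
split=> //; rewrite mulrC -ler_pdivrMr // ez Wi ler_wpM2l //.
  by rewrite mulr_ge0 // ltW.
by apply: le_trans al _; lra.
Qed.

Lemma simple_roots z : root f z -> ~~ (('X - z%:P) ^+ 2 %| f).
Proof. by move=> /root_in_disc[i hi]; exact: (one_root_per_disc hi hi). Qed.

Lemma exists_root_vector : exists xi : 'I_n -> K,
  root_vector f xi /\ forall i, abs (x i - xi i) <= r * d i.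
Proof.
have [rs fE] := closed_field_poly_normal f.
have size_rs : size rs = n.
  apply: succn_inj; rewrite -size_f {1}fE size_scale ?lead_coef_eq0 ?f_neq0 //.
  by rewrite size_prod_XsubC.
pose z (k : 'I_n) := rs`_k.
have fz : f = lead_coef f *: \prod_(k < n) ('X - (z k)%:P).
  by rewrite {1}fE (big_nth 0) size_rs big_mkord.
have rz k : root f (z k).
  by rewrite fz rootE hornerZ (bigD1 k) //= hornerM hornerXsubC subrr mul0r mulr0.
have [g hg] := fin_all_exists (fun k => root_in_disc (rz k)).
(* The indices k count roots with multiplicity: k != l makes (X - z_k)(X - z_l) divide f even if z_k
   = z_l. *)
have g_inj : injective g.
  move=> k l gkl; apply/eqP/negPn/negP => kl.
  have hl := hg l; rewrite -gkl in hl.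
  have /negP := one_root_per_disc (hg k) hl; apply.
  rewrite fz dvdpZr ?lead_coef_eq0 ?f_neq0 // (bigD1 k) //= (bigD1 l) 1?eq_sym //=.
  by rewrite mulrA dvdp_mulIl.
exists (fun i => z (invF g_inj i)); split=> [y|i]; last first.
  by rewrite -{1 3}(f_invF g_inj i).
rewrite {1}fz hornerZ horner_prod; congr (_ * _).
rewrite [RHS](reindex_inj g_inj) /=.
by apply: eq_bigr => k _; rewrite hornerXsubC invF_f.
Qed.

End Localization.

(** * Bernoulli's inequality, a chord bound and geometric decay *)

Lemma bernoulli_ineq (F : numDomainType) (h : F) k :
  0 <= h -> 1 + h *+ k <= (1 + h) ^+ k.
Proof.
move=> h0; elim: k => [|k IH]; first by rewrite mulr0n addr0 expr0.
rewrite exprSr; have h1 : 0 <= 1 + h by rewrite addr_ge0.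
apply: le_trans (ler_wpM2r h1 IH).
rewrite mulrDl mul1r mulrDr mulr1 addrA mulrSr addrA (addrAC 1) lerDl.
by rewrite mulr_ge0 ?mulrn_wge0.
Qed.

(** The convex function (1 + s)^k lies below its chord over [0, 1]. *)
Lemma expr1D_le (F : numDomainType) (s : F) k :
  0 <= s <= 1 -> (1 + s) ^+ k <= 1 + (2 ^+ k - 1) * s.
Proof.
move=> /andP[s0 s1]; elim: k => [|k IH]; first by rewrite !expr0 subrr mul0r addr0.
have h1 : 0 <= 1 + s by rewrite addr_ge0.
rewrite exprSr; apply: le_trans (ler_wpM2r h1 IH) _.
rewrite -subr_ge0.
have -> : 1 + (2 ^+ k.+1 - 1) * s - (1 + (2 ^+ k - 1) * s) * (1 + s) =
  (2 ^+ k - 1) * s * (1 - s) by rewrite exprS; ring.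
by rewrite !mulr_ge0 ?subr_ge0 // exprn_ege1 // ler1n.
Qed.

Lemma geometric_small (R : realType) (t M eps : R) :
  0 < t < 1 -> 0 <= M -> 0 < eps ->
  exists k0, forall k, (k0 <= k)%N -> t ^+ k * M < eps.
Proof.
move=> /andP[t0 t1] M0 eps0; pose h := t^-1 - 1.
have h0 : 0 < h by rewrite subr_gt0 invf_gt1.
have b0 : 0 <= M / (eps * h) by rewrite divr_ge0 // ltW // mulr_gt0.
exists (Num.bound (M / (eps * h))) => k hk.
have kE : M < eps * (h *+ k).
  have : M / (eps * h) < k%:R.
    by apply: lt_le_trans (archi_boundP b0) _; rewrite ler_nat.
  by rewrite ltr_pdivrMr ?mulr_gt0 // mulrC -mulrA mulr_natr.
have tk : 0 < t ^+ k by rewrite exprn_gt0.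
have : eps * (h *+ k) <= eps * (t^-1) ^+ k.
  rewrite ler_pM2l //; apply: le_trans (_ : 1 + h *+ k <= _); first by rewrite lerDr.
  have -> : t^-1 = 1 + h by rewrite addrC subrK.
  exact: bernoulli_ineq k (ltW h0).
move=> /(lt_le_trans kE); rewrite exprVn -(ltr_pM2l tk) mulrCA divff ?gt_eqF //.
by rewrite mulr1.
Qed.

(** * Contraction and order of the Weierstrass-type maps *)

Section Iteration.
Variables (R : realType) (K : closedFieldType) (abs : K -> R).
Hypothesis absP : is_absolute_value abs.
Variables (n : nat) (f : {poly K}) (xi : 'I_n -> K).
Hypotheses (n_ge2 : (2 <= n)%N) (f_neq0 : f != 0) (f_xi : root_vector f xi).
Implicit Types x y : 'I_n -> K.

(** The factor x_i - xi_i of f(x_i) comes out, leaving the product of the quotients (x_i - xi_j) /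
    (x_i - y_j). Keeping y arbitrary allows y = T^(m)(x) at every level of the recursion. *)
Lemma Weierstrass_step_error x y i : (forall j, j != i -> x i != y j) ->
  x i - f.[x i] / (lead_coef f * \prod_(j < n | j != i) (x i - y j)) - xi i =
  (x i - xi i) *
    (1 - \prod_(j < n | j != i) (1 + (y j - xi j) / (x i - y j))).
Proof.
move=> xy; have h j : j != i ->
    1 + (y j - xi j) / (x i - y j) = (x i - xi j) / (x i - y j).
  by move=> /xy; rewrite -subr_eq0 => nz; field.
rewrite (eq_bigr _ h) prodf_div f_xi (bigD1 i) //=.
have c0 : lead_coef f != 0 by rewrite lead_coef_eq0.
have p0 : \prod_(j < n | j != i) (x i - y j) != 0.
  by apply/prodf_neq0 => j /xy; rewrite subr_eq0.
by field; rewrite c0 p0.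
Qed.

Lemma Weierstrass_step_error_le x y i (s : 'I_n -> R) :
  (forall j, j != i -> x i != y j) ->
  (forall j, j != i -> abs (y j - xi j) <= s j * abs (x i - y j)) ->
  abs (x i - f.[x i] / (lead_coef f * \prod_(j < n | j != i) (x i - y j)) - xi i)
  <= abs (x i - xi i) * (\prod_(j < n | j != i) (1 + s j) - 1).
Proof.
move=> xy hs; rewrite Weierstrass_step_error // absM // ler_wpM2l ?abs_ge0 //.
rewrite (abs_distC absP); apply: le_trans (abs_prod1_le absP _ _) _.
rewrite lerD2r; apply: ler_prod => j ji.
rewrite addr_ge0 ?abs_ge0 //= lerD2l absM // absV // ler_pdivrMr ?hs //.
by rewrite abs_gt0 // subr_eq0 xy.
Qed.

Variables (a r : R).
Hypotheses (a_ge1 : 1 <= a) (r_gt0 : 0 < r) (r_le : r * (a + 2) <= 1).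
Hypothesis ar_le : (1 + (a + 2) * r / n%:R) ^+ n <= 2.

(** Solves (1 + rate)(1 + 2 r) = 2, equivalently 1 - 2 r (1 + rate) = rate. *)
Definition rate : R := (1 - 2 * r) / (1 + 2 * r).

Definition near_roots x : Prop :=
  [/\ forall i j, i != j -> x i != x j,
      forall i, abs (x i - xi i) <= r * dmin abs x i &
      forall i, \sum_(j < n | j != i) abs (x j - xi j) / dmin abs x j <= a * r].

Lemma rate_bounds : [/\ 0 < rate, rate < 1, r <= 3^-1 &
  (1 + rate) * (1 + 2 * r) = 2].
Proof.
have [[a1 r0] ra] := (a_ge1, r_gt0, r_le).
have r3 : r <= 3^-1 by nra.
rewrite /rate; split=> //; first by rewrite divr_gt0 //; lra.
  by rewrite ltr_pdivrMr; lra.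
by field; rewrite gt_eqF //; lra.
Qed.

Lemma prod_near_roots_le x i : near_roots x ->
  \prod_(j < n | j != i) (1 + abs (x j - xi j) / dmin abs x j) <= 1 + rate.
Proof.
move=> [x_inj _ hs]; have [_ _ _ rateE] := rate_bounds; have r0 := r_gt0.
pose e j := abs (x j - xi j) / dmin abs x j.
have e0 j : 0 <= e j by rewrite divr_ge0 ?abs_ge0 // ltW // dmin_gt0.
(* The free slot i receives 2 r, so that the n terms sum to at most n + (a + 2) r and the product
   acquires the factor 1 + 2 r. *)
pose F j := 1 + (if j == i then 2 * r else e j).
have F0 : {in 'I_n, forall j, 0 <= F j}.
  by move=> j _; rewrite /F; case: ifP => _; rewrite addr_ge0 //; lra.
have := leif_AGM F0; rewrite card_ord => -[+ _].
have -> : \prod_(j in 'I_n) F j =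
    (1 + 2 * r) * \prod_(j < n | j != i) (1 + e j).
  rewrite (bigD1 i) //= {1}/F eqxx; congr (_ * _).
  by apply: eq_bigr => j /negbTE ji; rewrite /F ji.
have n0 : 0 < n%:R :> R by rewrite ltr0n ltnW.
have : (\sum_(j in 'I_n) F j) / n%:R <= 1 + (a + 2) * r / n%:R.
  rewrite big_split /= sumr_const card_ord mulrDl divff ?gt_eqF // lerD2l.
  rewrite ler_pM2r ?invr_gt0 // (bigD1 i) //= eqxx.
  have -> : \sum_(j < n | j != i) (if j == i then 2 * r else e j) =
      \sum_(j < n | j != i) e j.
    by apply: eq_bigr => j /negbTE ->.
  by have := hs i; rewrite -/(e _) => {}hs; rewrite /e; lra.
move=> /(lerXn2r n) h1 h2.
have s0 : 0 <= (\sum_(j in 'I_n) F j) / n%:R.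
  by rewrite divr_ge0 ?ler0n // sumr_ge0.
have s1 : 0 <= 1 + (a + 2) * r / n%:R.
  by rewrite addr_ge0 // divr_ge0 ?ler0n // mulr_ge0 //; have := a_ge1; lra.
have p : 0 < 1 + 2 * r by lra.
rewrite -(ler_pM2r p) rateE mulrC.
exact: le_trans h2 (le_trans (h1 s0 s1) ar_le).
Qed.

Lemma near_roots_dist x i : near_roots x ->
  forall j, j != i -> abs (x i - xi i) <= r * abs (x i - x j).
Proof.
move=> [x_inj hr _] j ji; apply: le_trans (hr i) _.
by rewrite ler_wpM2l ?dmin_le // ltW.
Qed.

(** The invariant of the induction on m: the first half keeps denominators away from 0, the second
    is the hypothesis of [Weierstrass_step_error_le] with the relative errors of x itself,
    independent of m. *)
Definition Tmap_sep m x i j : Prop :=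
  rate * abs (x i - x j) <= abs (x i - Tmap f m x j) /\
  abs (Tmap f m x j - xi j) <=
    abs (x j - xi j) / dmin abs x j * abs (x i - Tmap f m x j).

Lemma sep_neq m x i j : near_roots x -> j != i -> Tmap_sep m x i j ->
  x i != Tmap f m x j.
Proof.
move=> [x_inj _ _] ji [+ _]; have [rt0 _ _ _] := rate_bounds.
rewrite -subr_eq0 -(abs_gt0 absP); apply: lt_le_trans.
by rewrite mulr_gt0 // abs_gt0 // subr_eq0 x_inj // eq_sym.
Qed.

Lemma sep_contract m x i : near_roots x ->
  (forall j, j != i -> Tmap_sep m x i j) ->
  abs (Tmap f m.+1 x i - xi i) <= rate * abs (x i - xi i).
Proof.
move=> hx hsep; pose s k := abs (x k - xi k) / dmin abs x k.
have h1 j : j != i -> x i != Tmap f m x j.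
  by move=> ji; apply: sep_neq (hsep j ji).
have h2 j : j != i -> abs (Tmap f m x j - xi j) <= s j * abs (x i - Tmap f m x j).
  by move=> /hsep[].
apply: le_trans (Weierstrass_step_error_le h1 h2) _.
rewrite mulrC ler_wpM2r ?abs_ge0 //.
by have := prod_near_roots_le i hx; rewrite -/s; lra.
Qed.

Lemma Tmap_separated x m : near_roots x -> forall i j, j != i -> Tmap_sep m x i j.
Proof.
move=> hx; have [x_inj _ _] := hx; have [rt0 rt1 r3 rateE] := rate_bounds.
have d0 j : 0 < dmin abs x j by apply: dmin_gt0.
have r0 := r_gt0.
have dle i j : j != i -> dmin abs x j <= abs (x i - x j).
  by move=> ji; rewrite (abs_distC absP) dmin_le // eq_sym.
elim: m => [|m IH] i j ji.
  split=> /=; first by rewrite ler_piMl ?abs_ge0 ?ltW.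
  by rewrite mulrAC ler_pdivlMr // ler_wpM2l ?abs_ge0 // dle.
have Tj_le := sep_contract hx (IH j).
rewrite /Tmap_sep; set Tj := Tmap f m.+1 x j in Tj_le *.
have ij : i != j by rewrite eq_sym.
have xj := near_roots_dist hx ij.
rewrite (abs_distC absP (x j) (x i)) in xj.
(* Moving x_j to T_j costs at most (1 + rate) r |x_i - x_j|, half of what 1 - 2 r (1 + rate) = rate
   allows. *)
have sep : rate * abs (x i - x j) <= abs (x i - Tj).
  have := abs_dist_triangle absP (x i) Tj (x j).
  have := abs_dist_triangle absP Tj (xi j) (x j).
  rewrite (abs_distC absP (xi j)).
  have : (1 + rate) * abs (x j - xi j) <= (1 + rate) * (r * abs (x i - x j)).
    by rewrite ler_wpM2l //; lra.
  have : 0 <= rate * r * abs (x i - x j).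
    by rewrite mulr_ge0 ?abs_ge0 // mulr_ge0 // ltW.
  have : (1 + rate) * (1 + 2 * r) * abs (x i - x j) = 2 * abs (x i - x j).
    by rewrite rateE.
  have : 0 <= r * abs (x i - x j) by rewrite mulr_ge0 ?abs_ge0 // ltW.
  lra.
(* The factor [rate] gained on the error cancels the one lost on the distance. *)
split=> //; apply: le_trans Tj_le _.
rewrite [leRHS]mulrAC ler_pdivlMr // -[leLHS]mulrA [leLHS]mulrCA ler_wpM2l ?abs_ge0 //.
by apply: le_trans sep; rewrite ler_pM2l // dle.
Qed.

Lemma Tmap_neq x m i j : near_roots x -> j != i -> x i != Tmap f m x j.
Proof. by move=> hx ji; apply: sep_neq (Tmap_separated m hx ji). Qed.

Lemma near_roots_Dom x m : near_roots x -> Dom f m x.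
Proof.
by move=> hx; elim: m => //= m IH; split=> // i j ij; apply: Tmap_neq; rewrite // eq_sym.
Qed.

Lemma Tmap_contract x m i : near_roots x ->
  abs (Tmap f m.+1 x i - xi i) <= rate * abs (x i - xi i).
Proof.
by move=> hx; apply: sep_contract => // j ji; apply: Tmap_separated.
Qed.

Lemma near_roots_Tmap x m : near_roots x -> near_roots (Tmap f m.+1 x).
Proof.
move=> hx; have [rt0 rt1 r3 rateE] := rate_bounds; have r0 := r_gt0.
have [x_inj hr hs] := hx; set T := Tmap f m.+1 x.
(* Now both endpoints move, which uses up the whole allowance 2 r (1 + rate). *)
have sep i j : j != i -> rate * abs (x i - x j) <= abs (T i - T j).
  move=> ji; have ij : i != j by rewrite eq_sym.
  have hi := near_roots_dist hx ji; have hj := near_roots_dist hx ij.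
  rewrite (abs_distC absP (x j) (x i)) in hj.
  have Ti := Tmap_contract m i hx; have Tj := Tmap_contract m j hx.
  rewrite -/T in Ti Tj.
  have := abs_dist_triangle absP (x i) (xi i) (x j).
  have := abs_dist_triangle absP (xi i) (T i) (x j).
  have := abs_dist_triangle absP (T i) (T j) (x j).
  have := abs_dist_triangle absP (T j) (xi j) (x j).
  rewrite (abs_distC absP (xi j) (x j)) (abs_distC absP (xi i) (T i)).
  have : (1 + rate) * abs (x j - xi j) <= (1 + rate) * (r * abs (x i - x j)).
    by rewrite ler_wpM2l //; lra.
  have : (1 + rate) * abs (x i - xi i) <= (1 + rate) * (r * abs (x i - x j)).
    by rewrite ler_wpM2l //; lra.
  have : (1 + rate) * (1 + 2 * r) * abs (x i - x j) = 2 * abs (x i - x j).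
    by rewrite rateE.
  lra.
have T_inj i j : i != j -> T i != T j.
  move=> ij; have /sep : j != i by rewrite eq_sym.
  rewrite -subr_eq0 -(abs_gt0 absP); apply: lt_le_trans.
  by rewrite mulr_gt0 // abs_gt0 // subr_eq0 x_inj.
have d0 i : 0 < dmin abs x i by apply: dmin_gt0.
have dT i : rate * dmin abs x i <= dmin abs T i.
  apply: le_dmin => // j ji; apply: le_trans (sep i j ji).
  by rewrite ler_pM2l // dmin_le.
have eT i : abs (T i - xi i) / dmin abs T i <= abs (x i - xi i) / dmin abs x i.
  rewrite ler_pdivrMr; last by apply: dmin_gt0.
  rewrite mulrAC ler_pdivlMr //.
  apply: le_trans (ler_wpM2r (ltW (d0 i)) (Tmap_contract m i hx)) _.
  by rewrite mulrAC mulrC ler_wpM2l ?abs_ge0.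
split=> // i; last by apply: le_trans (ler_sum _ _) (hs i) => j _.
rewrite -ler_pdivrMr; last by apply: dmin_gt0.
by apply: le_trans (eT i) _; rewrite ler_pdivrMr.
Qed.

(** Each level gains one power: an error of order m + 1 in T^(m)(x) makes the product minus 1 of
    that order, and it is multiplied by |x_i - xi_i|. The separation D of the roots makes the
    constant uniform in x. *)
Lemma Tmap_order (D : R) m : 0 < D ->
  (forall i j, j != i -> D <= abs (xi i - xi j)) ->
  exists C, 0 <= C /\ forall x, near_roots x -> forall i,
    abs (Tmap f m x i - xi i) <= C * errmax abs x xi ^+ m.+1.
Proof.
move=> D0 hD; have [rt0 rt1 r3 rateE] := rate_bounds; have r0 := r_gt0.
(* A lower bound for |x_i - T_k|, from D <= |xi_i - xi_k| <= (1 + 2 r) |x_i - x_k| and the factor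
   [rate]. *)
pose dl := rate * D / (1 + 2 * r).
have dl0 : 0 < dl by apply: divr_gt0; [exact: mulr_gt0|lra].
have err x i : abs (x i - xi i) <= errmax abs x xi.
  exact: (@le_bigmax_cond _ _ _ _ i xpredT).
have err0 x : 0 <= errmax abs x xi by exact: bigmax_ge_id.
elim: m => [|m [C [C0 IH]]].
  by exists 1; split=> // x _ i /=; rewrite mul1r expr1.
exists (2 ^+ n * (C / dl)); split.
  by rewrite mulr_ge0 ?exprn_ge0 // divr_ge0 // ltW.
move=> x hx i; have [x_inj hr hs] := hx.
(* The cap at 1 makes [expr1D_le] applicable; when it is active, the relative error of x, at most r
   < 1, takes over. *)
set ep := errmax abs x xi; pose s := Num.min 1 (C * ep ^+ m.+1 / dl).
have s0 : 0 <= s.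
  by rewrite le_min ler01 /= divr_ge0 ?(ltW dl0) // mulr_ge0 // exprn_ge0 ?err0.
have s1 : s <= 1 by rewrite ge_min lexx.
have d0 j : 0 < dmin abs x j by apply: dmin_gt0.
have h1 k : k != i -> x i != Tmap f m x k by apply: Tmap_neq.
have h2 k : k != i -> abs (Tmap f m x k - xi k) <= s * abs (x i - Tmap f m x k).
  move=> ki; have ik : i != k by rewrite eq_sym.
  have [sep bnd] := Tmap_separated m hx ki.
  rewrite /s; case: (leP 1 (C * ep ^+ m.+1 / dl)) => _.
    rewrite mul1r; apply: le_trans bnd _.
    rewrite ler_piMl ?abs_ge0 // ler_pdivrMr // mul1r.
    by apply: le_trans (hr k) _; rewrite ler_piMl ?ltW //; lra.
  apply: le_trans (IH x hx k) _; rewrite mulrAC ler_pdivlMr //.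
  rewrite ler_wpM2l //; first by rewrite mulr_ge0 ?exprn_ge0 ?err0.
  apply: le_trans sep; rewrite /dl -mulrA ler_pM2l // ler_pdivrMr; last by lra.
  apply: le_trans (hD i k ki) _.
  have hi := near_roots_dist hx ki; have hk := near_roots_dist hx ik.
  rewrite (abs_distC absP (x k) (x i)) in hk.
  have := abs_dist_triangle absP (xi i) (x i) (xi k).
  have := abs_dist_triangle absP (x i) (x k) (xi k).
  rewrite (abs_distC absP (xi i) (x i)); lra.
apply: le_trans (Weierstrass_step_error_le h1 h2) _.
rewrite prodr_const; set k := #|_|.
have kn : (k <= n)%N by rewrite -[leqRHS]card_ord max_card.
have b1 : (1 + s) ^+ k - 1 <= 2 ^+ n * s.
  have s01 : 0 <= s <= 1 by rewrite s0.
  have := expr1D_le n s01.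
  have : (1 + s) ^+ k <= (1 + s) ^+ n by rewrite ler_weXn2l // lerDl.
  lra.
have s2 : s <= C * ep ^+ m.+1 / dl by rewrite ge_min lexx orbT.
have b2 : 2 ^+ n * s <= 2 ^+ n * (C * ep ^+ m.+1 / dl).
  by rewrite ler_wpM2l ?exprn_ge0.
have p0 : 0 <= (1 + s) ^+ k - 1 by rewrite subr_ge0 exprn_ege1 // lerDl.
apply: le_trans (ler_pM (abs_ge0 absP _) p0 (err x i) (le_trans b1 b2)) _.
rewrite -/ep [in leRHS]exprS le_eqVlt; apply/predU1P; left.
by field; rewrite gt_eqF.
Qed.

Section Convergence.
Variables (N : nat) (x0 : 'I_n -> K).
Hypotheses (N_gt0 : (1 <= N)%N) (near_x0 : near_roots x0).

Lemma near_roots_iterates k : near_roots (iterates f N x0 k).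
Proof.
by case: N N_gt0 => // m _; elim: k => //= k IH; apply: near_roots_Tmap.
Qed.

Lemma iterates_linear k i :
  abs (iterates f N x0 k i - xi i) <= rate ^+ k * abs (x0 i - xi i).
Proof.
have [rt0 _ _ _] := rate_bounds.
elim: k => [|k IH]; first by rewrite expr0 mul1r.
have hx := near_roots_iterates k; move: hx IH; rewrite [iterates _ _ _ k.+1]/=.
rewrite -/(iterates f N x0 k); case: N N_gt0 => // m _ hx IH.
apply: le_trans (Tmap_contract m i hx) _.
by rewrite exprS -mulrA ler_pM2l.
Qed.

Lemma iterates_converge : converges_to abs (iterates f N x0) xi.
Proof.
move=> eps eps0; have [rt0 rt1 _ _] := rate_bounds.
have rt01 : 0 < rate < 1 by rewrite rt0.
have M0 : 0 <= \sum_j abs (x0 j - xi j) by apply: sumr_ge0 => j _; apply: abs_ge0.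
have [k0 hk0] := geometric_small rt01 M0 eps0.
exists k0 => k /hk0 hk i; apply: le_lt_trans hk.
apply: le_trans (iterates_linear k i) _.
rewrite ler_wpM2l //; first by rewrite exprn_ge0 // ltW.
by rewrite (bigD1 i) //= lerDl sumr_ge0 // => j _; apply: abs_ge0.
Qed.

Lemma root_vector_inj i j : i != j -> xi i != xi j.
Proof.
move=> ij; have [_ _ r3 _] := rate_bounds; have [x_inj _ _] := near_x0.
have ji : j != i by rewrite eq_sym.
have hi := near_roots_dist near_x0 ji; have hj := near_roots_dist near_x0 ij.
rewrite (abs_distC absP (x0 j) (x0 i)) in hj.
have p : 0 < abs (x0 i - x0 j) by rewrite abs_gt0 // subr_eq0 x_inj.
apply/eqP => eq_xi.
have := abs_dist_triangle absP (x0 i) (xi i) (x0 j).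
rewrite {2}eq_xi (abs_distC absP (xi j)).
have : r * abs (x0 i - x0 j) <= 3^-1 * abs (x0 i - x0 j) by rewrite ler_wpM2r // ltW.
lra.
Qed.

Lemma iterates_order : conv_order abs (iterates f N x0) xi N.+1.
Proof.
(* Any positive lower bound serves, so the default 1 is harmless. *)
pose D := \big[Num.min/1]_(i < n) dmin abs xi i.
have D0 : 0 < D.
  apply/bigmin_gtP; split=> [|i _]; first exact: ltr01.
  exact: (dmin_gt0 absP i n_ge2 root_vector_inj).
have hD i j : j != i -> D <= abs (xi i - xi j).
  move=> /(dmin_le abs xi); apply: le_trans.
  exact: (@bigmin_le_cond _ _ _ _ i xpredT).
have [C [C0 hC]] := Tmap_order N D0 hD.
exists C; split=> // k; apply/bigmax_leP; split.
  by rewrite mulr_ge0 ?exprn_ge0 // bigmax_ge_id.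
by move=> i _; apply: hC; apply: near_roots_iterates.
Qed.

End Convergence.
End Iteration.

(** * Power means and the conjugate exponent *)

Lemma powR_bernoulli (R : realType) (u s : R) :
  0 <= u -> 1 <= s -> 1 + s * (u - 1) <= u `^ s.
Proof.
move=> u0; rewrite le_eqVlt => /predU1P[<-|s1].
  by rewrite powRr1 // mul1r addrC subrK.
have s0 : 0 < s by lra.
have c0 : 0 < s / (s - 1) by rewrite divr_gt0 ?subr_gt0.
have cE : s^-1 + (s / (s - 1))^-1 = 1.
  by rewrite invf_div; field; rewrite gt_eqF.
(* Young's inequality for the product u 1: u <= u^s / s + (s - 1) / s. *)
have := conjugate_powR u0 ler01 s0 c0 cE.
rewrite powR1 mulr1 mul1r invf_div => h.
have := ler_wpM2l (ltW s0) h.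
have -> : s * (u `^ s / s + (s - 1) / s) = u `^ s + (s - 1).
  by field; rewrite gt_eqF.
lra.
Qed.

(* Bernoulli's inequality at [w j / M], where [M] is the mean of [w]. *)
Lemma power_mean (R : realType) (I : finType) (P : pred I) (w : I -> R) (s : R) :
  1 <= s -> (0 < #|P|)%N -> (forall j, 0 <= w j) ->
  \sum_(j | P j) w j <=
    #|P|%:R `^ (1 - s^-1) * (\sum_(j | P j) w j `^ s) `^ s^-1.
Proof.
move=> s1 P0 w0; have s0 : 0 < s by lra.
set m : R := #|P|%:R; have m0 : 0 < m by rewrite ltr0n.
pose M := (\sum_(j | P j) w j) / m.
have sumE : \sum_(j | P j) w j = m * M by rewrite mulrC divfK // gt_eqF.
have : 0 <= M by rewrite divr_ge0 ?sumr_ge0 // ltW.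
rewrite le_eqVlt => /predU1P[M0|M0].
  by rewrite sumE -M0 mulr0 mulr_ge0 ?powR_ge0.
(* The linear terms w_j / M - 1 add up to 0. *)
have h : M `^ s * m <= \sum_(j | P j) w j `^ s.
  have hj j : P j -> M `^ s * (1 + s * (w j / M - 1)) <= w j `^ s.
    move=> _; have u0 : 0 <= w j / M by rewrite divr_ge0 // ltW.
    have wE : w j = M * (w j / M) by rewrite mulrC divfK ?gt_eqF.
    rewrite [X in _ <= X `^ s]wE powRM ?(ltW M0) //.
    by rewrite ler_wpM2l ?powR_ge0 ?powR_bernoulli.
  apply: le_trans (ler_sum _ hj); rewrite -mulr_sumr big_split /= sumr_const.
  rewrite -mulr_sumr sumrB sumr_const -mulr_suml sumE mulfK ?gt_eqF //.
  by rewrite subrr mulr0 addr0.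
have h2 : M * m `^ s^-1 <= (\sum_(j | P j) w j `^ s) `^ s^-1.
  have -> : M * m `^ s^-1 = (M `^ s * m) `^ s^-1.
    by rewrite powRM ?powR_ge0 ?(ltW m0) // -powRrM divff ?gt_eqF // powRr1 ?ltW.
  apply: ge0_ler_powR; rewrite ?invr_ge0 ?(ltW s0) // nnegrE.
    by rewrite mulr_ge0 ?powR_ge0 ?ltW.
  by rewrite sumr_ge0 // => j _; apply: powR_ge0.
rewrite sumE; apply: le_trans (ler_wpM2l (powR_ge0 _ _) h2).
rewrite [leRHS]mulrCA -powRD ?subrK ?powRr1 ?(ltW m0) 1?mulrC //.
by rewrite oner_eq0.
Qed.

Lemma card_ord_neq n (i : 'I_n) : #|[pred j | j != i]| = n.-1.
Proof.
by rewrite -[in RHS](card_ord n) -(cardC1 i); apply: eq_card.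
Qed.

Section ConjugateExponent.
Variables (R : realType) (n : nat) (p : \bar R).
Hypotheses (n_ge2 : (2 <= n)%N) (p_ge1 : (1 <= p)%E).

Lemma a_param_ge1 : 1 <= a_param n p.
Proof.
have h : 1 <= n.-1%:R :> R by rewrite ler1n -ltnS prednK // ltnW.
rewrite /a_param -[leLHS](powRr0 n.-1%:R) ler_powR //.
move: p_ge1; rewrite /inv_conj; case: p => //= s; rewrite lee_fin => s1.
by rewrite subr_ge0 invf_le1 // (lt_le_trans ltr01).
Qed.

Variable w : 'I_n -> R.
Hypothesis w_ge0 : forall i, 0 <= w i.

Lemma le_pnorm i : w i <= pnorm p w.
Proof.
move: p_ge1; rewrite /pnorm; case: p => [s|_|//]; last first.
  by rewrite -[leLHS]ger0_norm //; exact: (@le_bigmax_cond _ _ _ _ i xpredT).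
rewrite lee_fin => s1; have s0 : 0 < s by lra.
rewrite -[leLHS]powRr1 // -[X in w i `^ X](@divff _ s) ?gt_eqF // powRrM.
have ws j : 0 <= `|w j| `^ s by exact: powR_ge0.
apply: ge0_ler_powR; rewrite ?nnegrE ?powR_ge0 ?sumr_ge0 ?invr_ge0 ?(ltW s0) //.
by rewrite (bigD1 i) //= ger0_norm // lerDl sumr_ge0.
Qed.

(** Hölder's inequality against the constant vector 1 on the n - 1 indices other than i. *)
Lemma sum_le_pnorm i : \sum_(j < n | j != i) w j <= a_param n p * pnorm p w.
Proof.
have n1 : (0 < n.-1)%N by rewrite -ltnS prednK // ltnW.
have h0 := p_ge1; rewrite /a_param /pnorm /inv_conj.
move: h0; case: p le_pnorm => [s||] hw // s1; last first.
  rewrite powRr1 // -[X in X%:R * _](card_ord_neq i) mulr_natl -sumr_const.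
  by apply: ler_sum => j _; apply: hw.
rewrite lee_fin in s1; have s0 : 0 < s by lra.
have := @power_mean _ _ [pred j | j != i] w s s1; rewrite card_ord_neq.
move=> /(_ n1 w_ge0) h; apply: le_trans h _.
rewrite ler_wpM2l ?powR_ge0 //.
have ws j : 0 <= w j `^ s by exact: powR_ge0.
have ws' j : 0 <= `|w j| `^ s by exact: powR_ge0.
apply: ge0_ler_powR; rewrite ?nnegrE ?sumr_ge0 ?invr_ge0 ?(ltW s0) //.
rewrite [leRHS](bigD1 i) //= -[leLHS]add0r lerD //.
by apply: ler_sum => j _; rewrite ger0_norm.
Qed.

End ConjugateExponent.

(** * The disc radius r and the threshold on E_f *)

Section Radius.
Variables (R : realType) (n : nat) (a : R).
Hypotheses (n_ge2 : (2 <= n)%N) (a_ge1 : 1 <= a).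

(** The solution r of (1 + (a + 2) r / n)^n = 2, where the AM-GM bound is saturated. *)
Definition second_kind_radius : R := n%:R * (2 `^ n%:R^-1 - 1) / (a + 2).

Lemma second_kind_radius_bounds :
  [/\ 0 < second_kind_radius, second_kind_radius * (a + 2) <= 1 &
      (1 + (a + 2) * second_kind_radius / n%:R) ^+ n <= 2].
Proof.
have n0 : 0 < n%:R :> R by rewrite ltr0n ltnW.
have a2 : 0 < a + 2 by have := a_ge1; lra.
rewrite /second_kind_radius; set b : R := 2 `^ n%:R^-1.
have bn : b ^+ n = 2.
  by rewrite -powR_mulrn ?powR_ge0 // -powRrM mulVf ?gt_eqF // powRr1.
have b1 : 1 < b.
  rewrite ltNge; apply/negP => b1.
  have b0 : 0 <= b by exact: powR_ge0.
  by have := exprn_ile1 n b0 b1; rewrite bn; lra.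
split; first by rewrite divr_gt0 // mulr_gt0 // subr_gt0.
- rewrite divfK ?gt_eqF //.
  have b1' : 0 <= b - 1 by lra.
  have := bernoulli_ineq n b1'.
  rewrite [X in _ <= X ^+ n]addrC subrK bn -mulr_natl; lra.
- have -> : 1 + (a + 2) * (n%:R * (b - 1) / (a + 2)) / n%:R = b.
    by field; rewrite !gt_eqF.
  by rewrite bn.
Qed.

(** The threshold is the value of r (1 - r) / (1 + (a - 1) r) at this r, so E_f below it is the
    localization hypothesis [E_le]. *)
Lemma radiusE : radius n a * (1 + (a - 1) * second_kind_radius) =
  second_kind_radius * (1 - second_kind_radius).
Proof.
have [r0 ra _] := second_kind_radius_bounds.
have a2 : 0 < a + 2 by have := a_ge1; lra.
move: r0 ra; rewrite /second_kind_radius /radius /=.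
set c := n%:R * _ => r0 ra.
have c0 : 0 < c by move: r0; rewrite pmulr_lgt0 // invr_gt0.
have ac : 0 <= (a - 1) * c by rewrite mulr_ge0 ?subr_ge0 // ltW.
by field; rewrite !gt_eqF //; lra.
Qed.

End Radius.

Theorem theorem3p5 (R : realType) (K : closedFieldType) (abs : K -> R)
  (n : nat) (f : {poly K}) (N : nat) (p : \bar R) (x0 : 'I_n -> K) :
  is_absolute_value abs ->
  (2 <= n)%N -> size f = n.+1 ->
  (1 <= N)%N -> (1 <= p)%E ->
  (forall i j : 'I_n, i != j -> x0 i != x0 j) ->
  Ef abs f p x0 < radius n (a_param n p) ->
  (forall z : K, root f z -> ~~ (('X - z%:P) ^+ 2 %| f)) /\
  (forall k, Dom f N (iterates f N x0 k)) /\
  exists xi : 'I_n -> K,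
    [/\ root_vector f xi,
        converges_to abs (iterates f N x0) xi,
        conv_order abs (iterates f N x0) xi N.+1 &
        forall k, Ef abs f p (iterates f N x0 k) <= radius n (a_param n p) ->
          forall i, abs (iterates f N x0 k i - xi i)
                    <= alpha (a_param n p) (Ef abs f p (iterates f N x0 k))
                       * abs (Wcorr f (iterates f N x0 k) i)].
Proof.
move=> absP n2 size_f N1 p1 x0_inj E0.
set a := a_param n p; have a1 : 1 <= a by apply: a_param_ge1.
pose r := second_kind_radius n a.
have [r0 ra arn] := second_kind_radius_bounds n2 a1.
have f0 : f != 0 by rewrite -size_poly_eq0 size_f.
have W0 (x : 'I_n -> K) : (forall i j, i != j -> x i != x j) ->
    forall i, 0 <= abs (Wcorr f x i) / dmin abs x i.
  move=> x_inj i; apply: divr_ge0; first exact: abs_ge0 absP _.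
  exact: ltW (dmin_gt0 absP i n2 x_inj).
have W_le (x : 'I_n -> K) (x_inj : forall i j, i != j -> x i != x j) i :
    abs (Wcorr f x i) / dmin abs x i <= Ef abs f p x.
  exact: (le_pnorm p1
    (w := fun i => abs (Wcorr f x i) / dmin abs x i) (W0 x x_inj)).
have W_sum (x : 'I_n -> K) (x_inj : forall i j, i != j -> x i != x j) i :
    \sum_(j < n | j != i) abs (Wcorr f x j) / dmin abs x j <= a * Ef abs f p x.
  exact: (sum_le_pnorm n2 p1
    (w := fun i => abs (Wcorr f x i) / dmin abs x i) (W0 x x_inj)).
have E_le (x : 'I_n -> K) : Ef abs f p x <= radius n a ->
    Ef abs f p x * (1 + (a - 1) * r) <= r * (1 - r).
  move=> hE; rewrite -radiusE // ler_wpM2r //.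
  by rewrite addr_ge0 // mulr_ge0 ?subr_ge0 // ltW.
have E0_le := E_le x0 (ltW E0).
(* Stated for any x, to serve both at [x0] and at later iterates. *)
have local x x_inj hE := root_dist_alpha absP n2 size_f x_inj a1 r0 ra (E_le x hE)
  (W_le x x_inj) (W_sum x x_inj).
split.
  exact: (simple_roots absP n2 size_f x0_inj a1 r0 ra E0_le (W_le x0 x0_inj)
    (W_sum x0 x0_inj)).
have [xi [f_xi hxi]] := exists_root_vector absP n2 size_f x0_inj a1 r0 ra E0_le
  (W_le x0 x0_inj) (W_sum x0 x0_inj).
have root_xi i : root f (xi i).
  by rewrite rootE f_xi (bigD1 i) //= subrr mul0r mulr0.
have near0 : near_roots abs xi a r x0.
  split=> // i; have d0 j : 0 < dmin abs x0 j by apply: dmin_gt0.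
  have al j := local x0 x0_inj (ltW E0) j (xi j) (root_xi j) (hxi j).
  have [al0 _ alE] := al i.
  (* Summing |x_j - xi_j| <= alpha |W_j| over j != i gives at most alpha a E, and alpha E <= r. *)
  apply: le_trans (_ : alpha a (Ef abs f p x0) * (a * Ef abs f p x0) <= _).
    apply: le_trans (ler_wpM2l (ltW al0) (W_sum x0 x0_inj i)).
    rewrite mulr_sumr; apply: ler_sum => j _; have [_ alj _] := al j.
    by rewrite mulrA ler_pM2r ?invr_gt0.
  by rewrite mulrCA ler_wpM2l // (le_trans ler01).
have near k : near_roots abs xi a r (iterates f N x0 k).
  exact: (near_roots_iterates absP n2 f0 f_xi a1 r0 ra arn N1 near0).
split; first by move=> k; exact: (near_roots_Dom absP n2 f0 f_xi a1 r0 ra arn N (near k)).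
exists xi; split=> //.
- exact: (iterates_converge absP n2 f0 f_xi a1 r0 ra arn N1 near0).
- exact: (iterates_order absP n2 f0 f_xi a1 r0 ra arn N1 near0).
(* The invariant keeps xi_i in the i-th disc of every iterate, so the numbering of the roots never
   has to be matched again. *)
- move=> k hE i; have [x_inj hr _] := near k.
  by have [_ ? _] := local _ x_inj hE i (xi i) (root_xi i) (hr i).
Qed.
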